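(* Let $a<b$ be real numbers and let $f:[a,b]\to\mathbb{R}$ be a function such that $f'$ is absolutely continuous on $[a,b]$ and $f''\in L_1[a,b]$. If $|f''|$ is convex on $[a,b]$, then for all $x\in\left[a,\frac{a+b}{2}\right]$, $$\left|\frac{1}{b-a}\int_a^b f(t)\,dt-\frac12\left[f(x)+f(a+b-x)\right]+\frac12\left(x-\frac{3a+b}{4}\right)\left[f'(x)-f'(a+b-x)\right]\right|$$ $$\le \frac{(x-a)^3}{24(b-a)}\left[|f''(a)|+|f''(b)|\right]+\frac{6(x-a)^3+(a+b-2x)^3}{48(b-a)}\left[|f''(x)|+|f''(a+b-x)|\right].$$
   Context: The derivatives $f'$ and $f''$ are the first and second derivatives of $f$ on $[a,b]$ (one-sided at the endpoints); the hypothesis that $|f''|$ is convex on $[a,b]$ is understood to include that $f''$ is defined on $[a,b]$. $L_1[a,b]$ is the space of Lebesgue integrable functions on $[a,b]$. *)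

(* Defs.v *)
From HB Require Import structures.
From mathcomp Require Import all_boot all_order all_algebra.
From mathcomp Require Import all_classical all_reals all_analysis.

Set Implicit Arguments.
Unset Strict Implicit.
Unset Printing Implicit Defensive.

Import Order.TTheory GRing.Theory Num.Theory.
Import numFieldNormedType.Exports.

Local Open Scope classical_set_scope.
Local Open Scope ring_scope.

(* A function on a set [A] is represented by a total function [f : R -> R] whose
   values outside [A] are not used.  The limit of the difference quotient at a
   point [x] of [A] is taken along [A]: for [A = `[a, b]] it is the two-sided
   derivative at interior points and the one-sided one at [a] and at [b]. *)
Definition diff_quotient (R : realType) (f : R -> R) (x y : R) : R :=
  (f y - f x) / (y - x).

Definition derivable1_within (R : realType) (A : set R) (f : R -> R) (x : R) :
    Prop :=
  cvg (diff_quotient f x y @[y --> within A x^']).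

(* Meaningful only where [derivable1_within A f x] holds. *)
Definition derive1_within (R : realType) (A : set R) (f : R -> R) (x : R) : R :=
  lim (diff_quotient f x y @[y --> within A x^']).

Definition absolutely_continuous_on (R : realType) (a b : R) (g : R -> R) :
    Prop :=
  forall e : R, 0 < e -> exists2 d : R, 0 < d &
    forall (n : nat) (u v : 'I_n -> R),
      (forall i, [/\ a <= u i, u i < v i & v i <= b]) ->
      trivIset setT (fun i : 'I_n => `]u i, v i[%classic) ->
      \sum_(i < n) (v i - u i) < d ->
      \sum_(i < n) `|g (v i) - g (u i)| < e.

(* Main.v *)
Require Import Defs.
From HB Require Import structures.
From mathcomp Require Import all_boot all_order all_algebra.
From mathcomp Require Import all_classical all_reals all_analysis.
From mathcomp Require Import ring lra.

Set Implicit Arguments.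
Unset Strict Implicit.
Unset Printing Implicit Defensive.

Import Order.TTheory GRing.Theory Num.Theory.
Import numFieldNormedType.Exports.

Local Open Scope classical_set_scope.
Local Open Scope ring_scope.

(** Put y = a + b - x, m = (a + b) / 2, and let K be the Peano kernel equal to
    (t - a)^2 / 2 on [a, x], to (t - m)^2 / 2 on [x, y] and to (t - b)^2 / 2 on
    [y, b].  Two integrations by parts on each piece show that the expression
    inside the absolute value on the left is (b - a)^-1 times the integral of
    K f''.  Since K >= 0, it remains to bound |f''| on each piece by the chord
    of this convex function and to integrate a polynomial.

    The integral of K f'' is read as the increment of a primitive.  On a piece
    [u, v] with kernel centre c, let F be a primitive of f.  Then
      G t = F t - (t - c) f t + (t - c)^2 / 2 * f' t
    is continuous on [u, v] and satisfies G' t = (t - c)^2 / 2 * f'' t inside,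
    so |G'| <= H' where the polynomial H is a primitive of (t - c)^2 / 2 times
    the chord; the mean value theorem then gives |G v - G u| <= H v - H u.
    This is [trapezoid_segment_le], the heart of the proof, with
    [normr_increment_le] as its mean value step and [convex_function_chord] as
    its use of convexity.  The three pieces add up in
    [two_point_quadrature_le].  The primitive of f used in the end is
    y |-> \int_a^y f, which is available because f is differentiable, hence
    continuous, on [a, b]. *)

(** As in the two-sided case, f y = f x + (y - x) * diff_quotient f x y, which
    also holds at y = x; this makes the limit along the punctured neighbourhood
    equal to f x, and the point x itself is harmless. *)
Lemma derivable1_within_continuous (R : realType) (A : set R) (f : R -> R) :
  (forall x, A x -> derivable1_within A f x) -> {within A, continuous f}.
Proof.
move=> df; apply/subspace_continuousP => x Ax.
have : f @ within A x^' --> f x.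
  have -> : f = (fun y => f x + (y - x) * diff_quotient f x y).
    apply/funext => y; have [->|yx] := eqVneq y x; first by rewrite subrr; ring.
    by rewrite /diff_quotient; field; rewrite subr_eq0.
  rewrite [X in _ --> X](_ : _ = f x + (x - x) * derive1_within A f x); last first.
    by rewrite subrr; ring.
  apply: cvgD; first exact: cvg_cst.
  apply: cvgM; last exact: df.
  apply: cvgB; last exact: cvg_cst.
  exact: (cvg_trans (cvg_within _) (@nbhs_dnbhs _ x)).
move=> /cvgrPdist_lt fx; apply/cvgrPdist_lt => e e0.
have {fx} : nbhs x [set y | y != x -> A y -> `|f x - f y| < e] := fx e e0.
apply: filterS => y fy Ay; have [->|yx] := eqVneq y x; last exact: fy.
by rewrite subrr normr0.
Qed.

(** At an interior point the restriction to A does not change the limit, so the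
    one-sided or relative derivative is the ordinary one. *)
Lemma is_derive1_derive1_within (R : realType) (A : set R) (f : R -> R) (x : R) :
  nbhs x A -> derivable1_within A f x -> is_derive x 1 f (derive1_within A f x).
Proof.
move=> nA; rewrite /derivable1_within /derive1_within.
set l := lim _ => df.
have {df} : diff_quotient f x y @[y --> x^'] --> l.
  move: df => /cvgrPdist_lt df; apply/cvgrPdist_lt => e e0.
  have {df} : nbhs x [set y | y != x -> A y -> `|l - diff_quotient f x y| < e] :=
    df e e0.
  by apply: filterS2 nA => y Ay + yx; apply.
move=> /cvgrPdist_lt dfx.
suff H : h^-1 *: (f (h *: (1 : R) + x) - f x) @[h --> 0^'] --> l.
  by apply: DeriveDef; [apply/cvg_ex; exists l|apply/cvg_lim].
apply/cvgrPdist_lt => e e0; have [d /= d0 xd] := dfx e e0.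
exists d => //= h /= hd h0.
have -> : h^-1 *: (f (h *: (1 : R) + x) - f x) = diff_quotient f x (h + x).
  by rewrite /diff_quotient /GRing.scale /= mulr1 addrK mulrC.
apply: xd; last by rewrite -subr_eq0 addrK.
by move: hd; rewrite /ball_ /= sub0r opprD addrCA subrr addr0.
Qed.

(** The chord inequality is multiplied by v - u so that it also covers the
    degenerate segment u = v. *)
Lemma convex_function_chord (R : realType) (D : set R) (g : R -> R) (u v t : R) :
  @convex_function R R^o D g -> D u -> D v -> u <= t <= v ->
  (v - u) * g t <= (v - t) * g u + (t - u) * g v.
Proof.
move=> cg Du Dv /andP[ut tv].
have [uv|uv] := eqVneq u v.
  have -> : t = u by apply/eqP; rewrite eq_le ut uv tv.
  by rewrite uv; lra.
have vu0 : v - u != 0 by rewrite subr_eq0 eq_sym.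
have lt_uv : 0 < v - u by rewrite subr_gt0 lt_neqAle uv (le_trans ut).
have p0 : 0 <= (v - t) / (v - u).
  by apply: divr_ge0; rewrite ?subr_ge0 // (le_trans ut tv).
have p1 : (v - t) / (v - u) <= 1 by rewrite ler_pdivrMr // mul1r lerD2l lerN2.
have convE (y z : R) : @conv R (convex_lmodType R^o) (Itv01 p0 p1) y z =
    ((v - t) * y + (t - u) * z) / (v - u).
  by rewrite /conv /= /unstable.onem /GRing.scale /=; field.
have convt : @conv R (convex_lmodType R^o) (Itv01 p0 p1) u v = t.
  by rewrite convE; field.
have : g (@conv R (convex_lmodType R^o) (Itv01 p0 p1) u v) <=
    @conv R (convex_lmodType R^o) (Itv01 p0 p1) (g u) (g v).
  exact: cg (mem_set Du) (mem_set Dv).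
by rewrite convt convE ler_pdivlMr // mulrC.
Qed.

(** The mean value theorem applied to H - G and to H + G, whose derivatives are
    nonnegative: the counterpart, for primitives, of bounding the integral of g
    by that of h. *)
Lemma normr_increment_le (R : realType) (G H g h : R -> R) (u v : R) :
  u <= v ->
  {within `[u, v], continuous G} -> {within `[u, v], continuous H} ->
  (forall t, t \in `]u, v[ -> is_derive t 1 G (g t)) ->
  (forall t, t \in `]u, v[ -> is_derive t 1 H (h t)) ->
  (forall t, t \in `[u, v] -> `|g t| <= h t) ->
  `|G v - G u| <= H v - H u.
Proof.
move=> uv cG cH dG dH gh.
have [| |t tuv HG1] := @MVT_segment R (H - G) (h - g) u v uv.
  by move=> t tuv; apply: is_deriveB; [exact: dH|exact: dG].
  by move=> t; apply: cvgB; [exact: cH|exact: cG].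
have [| |s suv HG2] := @MVT_segment R (H + G) (h + g) u v uv.
  by move=> s suv; apply: is_deriveD; [exact: dH|exact: dG].
  by move=> s; apply: cvgD; [exact: cH|exact: cG].
have := gh _ tuv; have := gh _ suv.
rewrite !ler_norml => /andP[s1 s2] /andP[t1 t2].
move: HG1 HG2; rewrite !fctE => HG1 HG2.
have : 0 <= (h t - g t) * (v - u) by rewrite mulr_ge0 ?subr_ge0.
have : 0 <= (h s + g s) * (v - u) by rewrite mulr_ge0 ?subr_ge0 //; lra.
by rewrite -HG1 -HG2 => ? ?; apply/andP; split; lra.
Qed.

(** Two integrations by parts of (t - c)^2 / 2 * f2 t over [u, v], in the form
    of an increment bound for the primitive that they produce.  The right-hand
    side is the integral over [u, v] of (t - c)^2 / 2 times the affine function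
    with values A at u and B at v. *)
Lemma trapezoid_segment_le (R : realType) (F f f1 f2 : R -> R) (u v c A B : R) :
  u <= v ->
  {within `[u, v], continuous F} -> {within `[u, v], continuous f} ->
  {within `[u, v], continuous f1} ->
  (forall t, t \in `]u, v[ -> is_derive t 1 F (f t)) ->
  (forall t, t \in `]u, v[ -> is_derive t 1 f (f1 t)) ->
  (forall t, t \in `]u, v[ -> is_derive t 1 f1 (f2 t)) ->
  (forall t, t \in `[u, v] -> (v - u) * `|f2 t| <= (v - t) * A + (t - u) * B) ->
  `|F v - F u - ((v - c) * f v - (u - c) * f u)
    + 2^-1 * ((v - c) ^+ 2 * f1 v - (u - c) ^+ 2 * f1 u)|
  <= (v - u) / 24 *
     (((v - c) ^+ 2 + 2 * (u - c) * (v - c) + 3 * (u - c) ^+ 2) * A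
      + (3 * (v - c) ^+ 2 + 2 * (u - c) * (v - c) + (u - c) ^+ 2) * B).
Proof.
rewrite le_eqVlt => /predU1P[<- *|uv cF cf cf1 dF df df1 f2AB].
  by rewrite !subrr mulr0 addr0 normr0 !mul0r.
have vu0 : v - u != 0 by rewrite subr_eq0 gt_eqF.
pose w : R -> R := id - cst c.
pose G : R -> R := F - w * f + cst (2^-1) * (w ^+ 2 * f1).
(* (t - c)^2 / 2 times the affine function, rewritten in powers of t - c, is
   3 al (t - c)^2 + 4 be (t - c)^3. *)
pose al := (A * (v - c) - B * (u - c)) / (6 * (v - u)).
pose be := (B - A) / (8 * (v - u)).
pose H : R -> R := cst al * w ^+ 3 + cst be * w ^+ 4.
have cw : continuous w by move=> t; apply: cvgB; [exact: cvg_id|exact: cvg_cst].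
have cst_w (k : R) : {within `[u, v], continuous (cst k)}.
  by apply: continuous_subspaceT => t; exact: cvg_cst.
have cwi : {within `[u, v], continuous w} by exact: continuous_subspaceT.
have cX (n : nat) : {within `[u, v], continuous (w ^+ n)}.
  apply: continuous_subspaceT => t; elim: n => [|n IH]; first exact: cvg_cst.
  by rewrite exprS; apply: cvgM; [exact: cw|exact: IH].
have cG : {within `[u, v], continuous G}.
  apply: within_continuousD.
    by apply: within_continuousB => // t; apply: cvgM; [exact: cwi|exact: cf].
  move=> t; apply: cvgM; first exact: cst_w.
  by apply: cvgM; [exact: cX|exact: cf1].
have cH : {within `[u, v], continuous H}.
  by apply: within_continuousD => t; apply: cvgM; [exact: cst_w|exact: cX|
    exact: cst_w|exact: cX].
have dw (t : R) : is_derive t (1 : R) w 1.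
  refine (is_derive_eq (is_deriveB (is_derive_id _ _) (is_derive_cst _ _ _)) _).
  exact: subr0.
have dG t : t \in `]u, v[ -> is_derive t 1 G (2^-1 * (t - c) ^+ 2 * f2 t).
  move=> tuv; have dwf := is_deriveM (dw t) (df t tuv).
  have dwf1 := is_deriveM (is_deriveX 2 (dw t)) (df1 t tuv).
  refine (is_derive_eq (is_deriveD (is_deriveB (dF t tuv) dwf)
    (is_deriveM (is_derive_cst _ _ _) dwf1)) _).
  by rewrite /w !fctE /GRing.scale /=; field.
have dH t : t \in `]u, v[ ->
    is_derive t 1 H (al * (3 * (t - c) ^+ 2) + be * (4 * (t - c) ^+ 3)).
  move=> _; refine (is_derive_eq (is_deriveD
    (is_deriveM (is_derive_cst _ _ _) (is_deriveX 3 (dw t)))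
    (is_deriveM (is_derive_cst _ _ _) (is_deriveX 4 (dw t)))) _).
  by rewrite /w !fctE /GRing.scale /=; ring.
have dGH t : t \in `[u, v] -> `|2^-1 * (t - c) ^+ 2 * f2 t| <=
    al * (3 * (t - c) ^+ 2) + be * (4 * (t - c) ^+ 3).
  move=> /f2AB f2t.
  rewrite normrM ger0_norm; last by rewrite mulr_ge0 ?sqr_ge0.
  have -> : al * (3 * (t - c) ^+ 2) + be * (4 * (t - c) ^+ 3) =
     2^-1 * (t - c) ^+ 2 * (((v - t) * A + (t - u) * B) / (v - u)).
    by rewrite /al /be; field.
  apply: ler_wpM2l; first by rewrite mulr_ge0 ?sqr_ge0.
  by rewrite ler_pdivlMr ?subr_gt0 // mulrC.
have -> : F v - F u - ((v - c) * f v - (u - c) * f u)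
    + 2^-1 * ((v - c) ^+ 2 * f1 v - (u - c) ^+ 2 * f1 u) = G v - G u.
  by rewrite /G /w !fctE; ring.
have -> : (v - u) / 24 *
     (((v - c) ^+ 2 + 2 * (u - c) * (v - c) + 3 * (u - c) ^+ 2) * A
      + (3 * (v - c) ^+ 2 + 2 * (u - c) * (v - c) + (u - c) ^+ 2) * B) = H v - H u.
  by rewrite /H /w /al /be !fctE; field.
exact: normr_increment_le (ltW uv) cG cH dG dH dGH.
Qed.

Lemma Rintegral_is_derive1 (R : realType) (a b : R) (f : R -> R) (t : R) :
  {within `[a, b], continuous f} -> t \in `]a, b[ ->
  is_derive t 1 (fun y : R => \int[@lebesgue_measure R]_(s in `[a, y]) f s : R) (f t).
Proof.
move=> cf tab; move: (tab); rewrite in_itv /= => /andP[a_t tb].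
have intf : (@lebesgue_measure R).-integrable `[a, b] (EFin \o f).
  by apply: continuous_compact_integrable => //; exact: segment_compact.
have ft := within_continuous_continuous (lt_trans a_t tb) cf tab.
have [dFt Ft] := continuous_FTC1_closed tb intf a_t ft.
by have := derivableP dFt; rewrite -derive1E Ft.
Qed.

(** The three pieces [a, x], [x, y], [y, b] with centres a, (a + b) / 2 and b:
    the outer centres make the terms at a and b vanish, and with the middle one
    the values f x and f (a + b - x) both get the weight (b - a) / 2. *)
Lemma two_point_quadrature_le (R : realType) (a b : R) (F f f1 f2 : R -> R) :
  {within `[a, b], continuous F} -> {within `[a, b], continuous f} ->
  {within `[a, b], continuous f1} ->
  (forall t, t \in `]a, b[ -> is_derive t 1 F (f t)) ->
  (forall t, t \in `]a, b[ -> is_derive t 1 f (f1 t)) ->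
  (forall t, t \in `]a, b[ -> is_derive t 1 f1 (f2 t)) ->
  @convex_function R R^o `[a, b]%classic (fun t => `|f2 t|) ->
  a < b -> forall x : R, x \in `[a, (a + b) / 2] ->
    `| (b - a)^-1 * (F b - F a)
       - 2^-1 * (f x + f (a + b - x))
       + 2^-1 * (x - (3 * a + b) / 4) * (f1 x - f1 (a + b - x)) |
    <= (x - a) ^+ 3 / (24 * (b - a)) * (`|f2 a| + `|f2 b|)
       + (6 * (x - a) ^+ 3 + (a + b - 2 * x) ^+ 3) / (48 * (b - a))
         * (`|f2 x| + `|f2 (a + b - x)|).
Proof.
move=> cF cf cf1 dF df df1 cvx ab x; rewrite in_itv /= => /andP[ax xm].
have seg (u v c : R) : a <= u -> u <= v -> v <= b ->
  `|F v - F u - ((v - c) * f v - (u - c) * f u)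
    + 2^-1 * ((v - c) ^+ 2 * f1 v - (u - c) ^+ 2 * f1 u)|
  <= (v - u) / 24 *
     (((v - c) ^+ 2 + 2 * (u - c) * (v - c) + 3 * (u - c) ^+ 2) * `|f2 u|
      + (3 * (v - c) ^+ 2 + 2 * (u - c) * (v - c) + (u - c) ^+ 2) * `|f2 v|).
  move=> au uv vb.
  have sub : `[u, v] `<=` `[a, b] by apply: subset_itvScc.
  have subo t : t \in `]u, v[ -> t \in `]a, b[.
    rewrite !in_itv /= => /andP[ut tv].
    by rewrite (le_lt_trans au ut) (lt_le_trans tv vb).
  have uI : `[a, b]%classic u by rewrite /= in_itv /= au (le_trans uv vb).
  have vI : `[a, b]%classic v by rewrite /= in_itv /= vb (le_trans au uv).
  exact: (trapezoid_segment_le c uv (continuous_subspaceW sub cF)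
    (continuous_subspaceW sub cf) (continuous_subspaceW sub cf1)
    (fun t ht => dF t (subo t ht)) (fun t ht => df t (subo t ht))
    (fun t ht => df1 t (subo t ht)) (fun t => convex_function_chord cvx uI vI)).
have ba0 : 0 < b - a by rewrite subr_gt0.
have ba0' : b - a != 0 by rewrite gt_eqF.
pose y := a + b - x; pose m := (a + b) / 2.
have xm2 : x * 2 <= a + b by rewrite -ler_pdivlMr.
have xy : x <= y by rewrite /y; lra.
have yb : y <= b by rewrite /y; lra.
have s1 := seg a x a (lexx a) ax (le_trans xy yb).
have s2 := seg x y m ax xy yb.
have s3 := seg y b b (le_trans ax xy) yb (lexx b).
move: s1 s2 s3; set e1 := (X in `|X|); set e2 := (X in _ -> `|X| <= _ -> _);
  set e3 := (X in _ -> _ -> `|X| <= _ -> _) => s1 s2 s3.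
rewrite [X in `|X| <= _](_ : _ = (e1 + e2 + e3) / (b - a)); last first.
  by rewrite /e1 /e2 /e3 /m /y; field.
rewrite normf_div (gtr0_norm ba0) ler_pdivrMr //.
apply: le_trans (ler_normD _ _) _.
apply: le_trans (lerD (ler_normD _ _) (lexx _)) _.
apply: le_trans (lerD (lerD s1 s2) s3) _.
(* The three bounds add up exactly to the claimed one. *)
rewrite le_eqVlt; apply/orP; left; apply/eqP.
by rewrite /m /y; field.
Qed.

Theorem theorem3 (R : realType) (a b : R) (f : R -> R) :
  let I : set R := `[a, b]%classic in
  let f' := derive1_within I f in
  let f'' := derive1_within I f' in
  a < b ->
  (forall t, t \in `[a, b] -> derivable1_within I f t) ->
  absolutely_continuous_on a b f' ->
  (forall t, t \in `[a, b] -> derivable1_within I f' t) ->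
  (@lebesgue_measure R).-integrable I (EFin \o f'') ->
  @convex_function R R^o I (fun t => `|f'' t|) ->
  forall x : R, x \in `[a, (a + b) / 2] ->
    `| (b - a)^-1 * (\int[lebesgue_measure]_(t in I) f t)
       - 2^-1 * (f x + f (a + b - x))
       + 2^-1 * (x - (3 * a + b) / 4) * (f' x - f' (a + b - x)) |
    <= (x - a) ^+ 3 / (24 * (b - a)) * (`|f'' a| + `|f'' b|)
       + (6 * (x - a) ^+ 3 + (a + b - 2 * x) ^+ 3) / (48 * (b - a))
         * (`|f'' x| + `|f'' (a + b - x)|).
Proof.
move=> I f' f'' ab df _ df' _ cvx x xab.
have cf : {within I, continuous f} by apply: derivable1_within_continuous.
have cf' : {within I, continuous f'} by apply: derivable1_within_continuous.
have intf : (@lebesgue_measure R).-integrable I (EFin \o f).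
  by apply: continuous_compact_integrable => //; exact: segment_compact.
have dI (g : R -> R) : (forall t, t \in `[a, b] -> derivable1_within I g t) ->
    forall t, t \in `]a, b[ -> is_derive t 1 g (derive1_within I g t).
  move=> dg t tab; apply: is_derive1_derive1_within.
    apply: (@filterS _ (nbhs t) _ `]a, b[%classic); first exact: subset_itv_oo_cc.
    exact: near_in_itvoo.
  by apply: dg; exact: subset_itv_oo_cc.
have := two_point_quadrature_le (parameterized_integral_continuous (ltW ab) intf)
  cf cf' (fun t => Rintegral_is_derive1 cf) (dI f df) (dI f' df') cvx ab xab.
by rewrite /parameterized_integral set_itv1 Rintegral_set1 subr0.
Qed.
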